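(* Let $\Omega$ be a tiling space of $\mathbb{R}^d$ all of whose elements are repetitive tilings, let $v$ be a vertex of a tiling $T\in\Omega$, and let $R_v\subset\mathbb{R}^d$ be the return module of $v$. Equip $\Omega$ with the diffeology $\mathcal{D}$ and $\mathbb{T}_v=\mathbb{R}^d/R_v$ with the quotient diffeology of the standard diffeology on $\mathbb{R}^d$. Then $\Omega$ is a (diffeological) covering space over $\mathbb{T}_v=\mathbb{R}^d/R_v$.
   Context: Tilings. A tiling $T=\{t_i\}$ of $\mathbb{R}^d$ is a family of closed subsets (tiles) covering $\mathbb{R}^d$, with pairwise disjoint interiors, each a translate of one of finitely many proto-tiles, each proto-tile being homeomorphic to a closed $d$-disk (with tiles having vertices, e.g. endpoints of intervals if $d=1$). A patch is a finite connected union of tiles. $\mathbb{R}^d$ acts by $T+x=\{t+x:t\in T\}$, with orbits $O(T)$. Tiling metric: $T,T'$ are $\varepsilon$-close if there are $x,x'\in\mathbb{R}^d$ of norm less than $\varepsilon/2$ such that $T+x$ and $T'+x'$ coincide on the ball $B_{1/\varepsilon}(0)$. A tiling space $\Omega$ is a translation-invariant set of tilings that is complete for this metric. $T$ is repetitive if for every patch $P$ of $T$ there is $R>0$ such that every ball $B_R(x)$, $x\in\mathbb{R}^d$, contains a translate of $P$. Return module. For a patch $P$ of $T$, the return vectors of $P$ are the vectors $w$ such that the pattern of $T$ at $P+w$ coincides with $P$ (i.e. $P+w$ is another occurrence of $P$ in $T$); the return module $R_P$ is the $\mathbb{Z}$-span of the return vectors. For a vertex $v$ of $T$ the occurrences are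 the vertices of $T$, so $R_v$ is the $\mathbb{Z}$-span of the vectors $w$ such that $v+w$ is a vertex of $T$ (for $d=1$ and tile lengths $1,\alpha$, $R_v=\mathbb{Z}+\alpha\mathbb{Z}$). Diffeology. $\mathcal{D}$ is the finest diffeology on $\Omega$ such that the action $\mathbb{R}^d\times\Omega\to\Omega$, $(x,T)\mapsto T+x$, is smooth; equivalently it is the diffeology generated by the orbit maps $\hat T:\mathbb{R}^d\to\Omega$, $\hat T(x)=T+x$, $T\in\Omega$ (plots are the parametrizations that are locally constant or locally of the form $\hat T\circ Q$ with $Q$ smooth into $\mathbb{R}^d$). Coverings. For a smooth surjection $\pi:X\to B$ of diffeological spaces, the structure groupoid has objects $B$ and arrows the diffeomorphisms between fibers $\pi^{-1}(b)\to\pi^{-1}(b')$, with the coarsest groupoid diffeology such that evaluation $(\varphi,x)\mapsto\varphi(x)$ is smooth; $\pi$ is a diffeological fibration if the characteristic map $\varphi\mapsto(\text{source},\text{target})\in B\times B$ is a subduction. Equivalently, there is a diffeological space $F$ such that for every plot $P:U\to B$ the pullback $P^*(X)=\{(u,x):P(u)=\pi(x)\}\to U$ is locally trivial with fiber $F$. $X$ is a covering space over $B$ if there is a diffeological fibration $X\to B$ whose fiber is discrete (its plots are the locally constant parametrizations). *)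

(* Defs.v *)
(* The real numbers are an arbitrary [R : realType], and R^n is 'rV[R]_n. *)
From HB Require Import structures.
From mathcomp Require Import all_boot all_order all_algebra.
From mathcomp Require Import all_classical all_reals all_analysis.
Set Implicit Arguments.
Unset Strict Implicit.
Unset Printing Implicit Defensive.
Import Order.TTheory GRing.Theory Num.Theory.
Import numFieldNormedType.Exports.
Local Open Scope classical_set_scope.
Local Open Scope ring_scope.

(* On an open [U], [Ck k U f] says that [f] is k times continuously
   differentiable on [U]; the values of [f] outside [U] are irrelevant
   (lemma [eq_Ck]). *)
Fixpoint Ck (R : realType) n (W : normedModType R) (k : nat)
    (U : set 'rV[R]_n) (f : 'rV[R]_n -> W) : Prop :=
  if k is k'.+1 then
    (forall x, U x -> differentiable f x) /\
    (forall v, Ck k' U (fun x => 'd f x v))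
  else forall x, U x -> {for x, continuous f}.

Definition smooth_on (R : realType) n (W : normedModType R)
    (U : set 'rV[R]_n) (f : 'rV[R]_n -> W) : Prop :=
  forall k, Ck k U f.

Section smooth_on_theory.
Variable R : realType.

Lemma near_diff (V W : normedModType R) (f g : V -> W) x :
  (\forall y \near x, f y = g y) -> differentiable f x ->
  differentiable g x /\ 'd g x = 'd f x :> (V -> W).
Proof.
move=> fg df.
have [dfc dfE] := iffLR (diff_locallyP _ _) df.
have gE : g \o shift x = cst (g x) + 'd f x +o_ 0 id.
  apply/eqaddoP => e e0; move/eqaddoP/(_ e e0) : dfE => H.
  have fgx : f x = g x by exact: nbhs_singleton fg.
  have fg0 : \forall h \near 0, f (h + x) = g (h + x).
    by move: fg; rewrite [X in X -> _](near_shift 0)/= subr0; apply: filterS.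
  move: H fg0; apply: filterS2 => h /=.
  by rewrite /cst /= !fctE fgx => H <-.
have dE : 'd g x = 'd f x :> (V -> W) by exact: diff_unique.
by split => //; apply/diff_locallyP; rewrite dE.
Qed.

Section fixed_domain.
Variables (n : nat) (U : set 'rV[R]_n).
Hypothesis oU : open U.

Lemma eq_Ck (W : normedModType R) k (f g : 'rV[R]_n -> W) :
  (forall x, U x -> f x = g x) -> Ck k U f -> Ck k U g.
Proof.
elim: k f g => [|k IH] f g fg /=.
  move=> cf x Ux; have fgn : {near x, f =1 g}.
    by near=> y; apply: fg; near: y; exact: open_nbhs_nbhs.
  rewrite /prop_for /continuous_at -(fg _ Ux).
  exact: cvg_trans (near_eq_cvg fgn) (cf _ Ux).
move=> [df Cdf].
have fgn x : U x -> \forall y \near x, f y = g y.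
  by move=> Ux; near=> y; apply: fg; near: y; exact: open_nbhs_nbhs.
split=> [x Ux|v]; first exact: (near_diff (fgn x Ux) (df x Ux)).1.
apply: IH (Cdf v) => x Ux.
by rewrite (near_diff (fgn x Ux) (df x Ux)).2.
Unshelve. all: by end_near. Qed.

Lemma Ck_cst (W : normedModType R) k (a : W) : Ck k U (cst a : 'rV[R]_n -> W).
Proof.
elim: k a => [|k IH] a /=; first by move=> x _; exact: cst_continuous.
split=> [x _|v]; first exact: differentiable_cst.
by apply: eq_Ck (IH 0) => x _; rewrite diff_cst.
Qed.

Lemma CkW (W : normedModType R) k (f : 'rV[R]_n -> W) : Ck k.+1 U f -> Ck k U f.
Proof.
elim: k f => [|k IH] f [df Cdf].
  by move=> x Ux; exact/differentiable_continuous/df.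
by split=> // v; exact: IH.
Qed.

Lemma CkD (W : normedModType R) k (f g : 'rV[R]_n -> W) :
  Ck k U f -> Ck k U g -> Ck k U (fun x => f x + g x).
Proof.
elim: k f g => [|k IH] f g.
  by move=> cf cg x Ux; exact: (cvgD (cf x Ux) (cg x Ux)).
move=> [df Cdf] [dg Cdg]; split=> [x Ux|v].
  by apply: (@differentiableD _ _ _ f g); [exact: df|exact: dg].
apply: eq_Ck (IH _ _ (Cdf v) (Cdg v)) => x Ux.
by rewrite (@diffD _ _ _ f g x (df x Ux) (dg x Ux)).
Qed.

Lemma Ck_sum (W : normedModType R) k (I : Type) (s : seq I)
    (f : I -> 'rV[R]_n -> W) :
  (forall i, Ck k U (f i)) -> Ck k U (fun x => \sum_(i <- s) f i x).
Proof.
move=> Cf; elim: s => [|i s IH].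
  by apply: eq_Ck (Ck_cst k 0) => x _; rewrite big_nil.
by apply: eq_Ck (CkD (Cf i) IH) => x _; rewrite big_cons.
Qed.

Lemma Ck_linear (V W : normedModType R) k (L : {linear V -> W})
    (f : 'rV[R]_n -> V) :
  continuous L -> Ck k U f -> Ck k U (L \o f).
Proof.
move=> cL; elim: k f => [|k IH] f.
  by move=> cf x Ux; exact: (continuous_comp (cf x Ux) (@cL _)).
have dL y : differentiable L y by exact: linear_differentiable.
move=> [df Cdf]; split=> [x Ux|v].
  by apply: differentiable_comp; [exact: df|exact: dL].
apply: eq_Ck (IH _ (Cdf v)) => x Ux.
by rewrite (diff_comp (df x Ux) (dL _)) /= diff_lin.
Qed.

Lemma diff_scale (W : normedModType R) (a : 'rV[R]_n -> R)
    (f : 'rV[R]_n -> W) x :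
  differentiable a x -> differentiable f x ->
  differentiable (fun y => a y *: f y) x /\
  forall v, 'd (fun y => a y *: f y) x v = a x *: 'd f x v + 'd a x v *: f x.
Proof.
move=> da df.
have scale_lin : bilinear_for (GRing.Scale.Law.clone _ _ *:%R _)
    (GRing.Scale.Law.clone _ _ *:%R _) (@GRing.scale R W).
  by split=> [u|u] b y z /=; rewrite ?scalerDl ?scalerDr ?scalerA // mulrC.
pose sM := bilinear_isBilinear.Build R R W W _ _ (@GRing.scale R W) scale_lin.
pose s : {bilinear R -> W -> W} := HB.pack (@GRing.scale R W) sM.
have cs : continuous (fun p => s p.1 p.2) by exact: scale_continuous.
have dp := differentiable_pair da df.
have ds := differentiable_bilin (a x, f x) cs.
split=> [|v].
  exact: (@differentiable_comp _ _ _ _ (fun y => (a y, f y)) (fun p => s p.1 p.2)).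
rewrite -[X in 'd X _](_ : (fun p => s p.1 p.2) \o (fun y => (a y, f y)) = _) //.
by rewrite diff_comp// diff_bilin// diff_pair.
Qed.

Lemma Ck_scale (W : normedModType R) k (a : 'rV[R]_n -> R)
    (f : 'rV[R]_n -> W) :
  Ck k U a -> Ck k U f -> Ck k U (fun x => a x *: f x).
Proof.
elim: k a f => [|k IH] a f.
  by move=> ca cf x Ux; exact: (cvgZ (ca x Ux) (cf x Ux)).
move=> Ca Cf; have [da Cda] := Ca; have [df Cdf] := Cf; split=> [x Ux|v].
  exact: (diff_scale (da x Ux) (df x Ux)).1.
apply: eq_Ck (CkD (IH _ _ (CkW Ca) (Cdf v)) (IH _ _ (Cda v) (CkW Cf))) => x Ux.
by rewrite (diff_scale (da x Ux) (df x Ux)).2.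
Qed.

End fixed_domain.

Lemma Ck_comp n p (W : normedModType R) k (V : set 'rV[R]_p) (U : set 'rV[R]_n)
    (g : 'rV[R]_p -> 'rV[R]_n) (f : 'rV[R]_n -> W) :
  open V -> (forall x, V x -> U (g x)) -> Ck k V g -> Ck k U f ->
  Ck k V (f \o g).
Proof.
move=> oV VU; elim: k f => [|k IH] f.
  by move=> cg cf x Vx; exact: (continuous_comp (cg x Vx) (cf _ (VU x Vx))).
move=> Cg Cf; have [dg Cdg] := Cg; have [df Cdf] := Cf.
split=> [x Vx|v].
  exact: (differentiable_comp (dg x Vx) (df _ (VU x Vx))).
have coord_lin j : linear (fun N : 'rV[R]_n => N 0 j : R).
  by move=> a x y; rewrite !mxE.
have Ck_coord j : Ck k V (fun x => 'd g x v 0 j).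
  pose coordM := GRing.isLinear.Build _ _ _ _ _ (coord_lin j).
  pose coord : {linear 'rV[R]_n -> R} := HB.pack (fun N : 'rV[R]_n => N 0 j : R) coordM.
  by apply: (Ck_linear oV (L := coord)) (Cdg v); exact: coord_continuous.
have Cs j := Ck_scale oV (Ck_coord j) (IH _ (CkW Cg) (Cdf (delta_mx 0 j))).
apply: eq_Ck (Ck_sum oV (index_enum 'I_n) Cs) => // x Vx.
rewrite (diff_comp (dg x Vx) (df _ (VU x Vx))) /=.
rewrite [in RHS](row_sum_delta ('d g x v)) linear_sum /=.
by apply: eq_bigr => j _; rewrite linearZ.
Qed.

Lemma Ck_local n (W : normedModType R) k (U : set 'rV[R]_n)
    (f : 'rV[R]_n -> W) :
  (forall x, U x -> exists2 V : set 'rV[R]_n, V x & Ck k V f) -> Ck k U f.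
Proof.
elim: k f => [|k IH] f H; first by move=> x /H[V Vx CV]; exact: CV.
split=> [x /H[V Vx [dV _]]|v]; first exact: dV.
by apply: IH => x /H[V Vx [_ CV]]; exists V => //; exact: CV.
Qed.

End smooth_on_theory.

(* A parametrization of X is an open set U of some R^n together with a map
   U -> X; the latter is encoded by a total map whose values outside U are
   irrelevant ([plot_eq]). *)
Record diffeology (R : realType) (X : Type) := Diffeology {
  plot : forall n, set 'rV[R]_n -> ('rV[R]_n -> X) -> Prop;
  plot_open : forall n U P, @plot n U P -> open U;
  plot_eq : forall n U P Q, @plot n U P ->
    (forall u, U u -> P u = Q u) -> @plot n U Q;
  plot_cst : forall n U x, open U -> @plot n U (fun=> x);
  plot_local : forall n U P, open U ->
    (forall u, U u -> exists V, [/\ open V, V u, V `<=` U & @plot n V P]) ->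
    @plot n U P;
  plot_comp : forall m n (V : set 'rV[R]_m) U (F : 'rV[R]_m -> 'rV[R]_n) P,
    open V -> smooth_on V F -> (forall u, V u -> U (F u)) ->
    @plot n U P -> @plot m V (P \o F) }.
Arguments plot {R X} d {n} U P.

#[local] Obligation Tactic := idtac.

Section diffeology_constructions.
Variable R : realType.
Implicit Types X Y : Type.

Definition smooth X Y (DX : diffeology R X) (DY : diffeology R Y)
    (f : X -> Y) : Prop :=
  forall n (U : set 'rV[R]_n) P, plot DX U P -> plot DY U (f \o P).

Definition finer X (D D' : diffeology R X) : Prop :=
  forall n (U : set 'rV[R]_n) P, plot D U P -> plot D' U P.

Definition coarsest X (C : diffeology R X -> Prop) (D : diffeology R X) : Prop :=
  C D /\ forall D', C D' -> finer D' D.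

Definition finest X (C : diffeology R X -> Prop) (D : diffeology R X) : Prop :=
  C D /\ forall D', C D' -> finer D D'.

(* The intersection of all diffeologies satisfying [C]; it is the finest
   diffeology satisfying [C] as soon as it satisfies [C]. *)
Program Definition finest_diffeology X (C : diffeology R X -> Prop) :
    diffeology R X :=
  @Diffeology R X (fun n U P => open U /\ forall D, C D -> plot D U P)
    _ _ _ _ _.
Next Obligation. by move=> X C n U P []. Qed.
Next Obligation.
move=> X C n U P Q [oU CP] PQ; split=> // D CD; exact: plot_eq (CP D CD) PQ.
Qed.
Next Obligation. by move=> X C n U x oU; split=> // D CD; exact: plot_cst. Qed.
Next Obligation.
move=> X C n U P oU loc; split=> // D CD; apply: plot_local => // u /loc.
by move=> [V [oV Vu VU [_ CP]]]; exists V; split=> //; exact: CP.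
Qed.
Next Obligation.
move=> X C m n V U F P oV sF VU [oU CP]; split=> // D CD.
exact: plot_comp oV sF VU (CP D CD).
Qed.

Program Definition std_diffeology d : diffeology R 'rV[R]_d :=
  @Diffeology R 'rV[R]_d (fun n U P => open U /\ smooth_on U P) _ _ _ _ _.
Next Obligation. by move=> d n U P []. Qed.
Next Obligation.
by move=> d n U P Q [oU sP] PQ; split=> // k; exact: (eq_Ck oU PQ (sP k)).
Qed.
Next Obligation. by move=> d n U x oU; split=> // k; exact: Ck_cst. Qed.
Next Obligation.
move=> d n U P oU loc; split=> // k; apply: Ck_local => u /loc.
by move=> [V [_ Vu _ [_ sP]]]; exists V.
Qed.
Next Obligation.
move=> d m n V U F P oV sF VU [oU sP]; split=> // k.
exact: (Ck_comp oV VU (sF k) (sP k)).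
Qed.

Program Definition prod_diffeology X Y (DX : diffeology R X)
    (DY : diffeology R Y) : diffeology R (X * Y) :=
  @Diffeology R (X * Y)
    (fun n U P => plot DX U (fst \o P) /\ plot DY U (snd \o P)) _ _ _ _ _.
Next Obligation. by move=> X Y DX DY n U P [/plot_open]. Qed.
Next Obligation.
move=> X Y DX DY n U P Q [P1 P2] PQ.
by split; [apply: plot_eq P1 _ | apply: plot_eq P2 _] => u Uu /=; rewrite PQ.
Qed.
Next Obligation.
by move=> X Y DX DY n U [x y] oU; split; exact: plot_cst.
Qed.
Next Obligation.
move=> X Y DX DY n U P oU loc.
split; apply: plot_local => // u /loc [V [oV Vu VU [P1 P2]]]; exists V;
  by split.
Qed.
Next Obligation.
move=> X Y DX DY m n V U F P oV sF VU [P1 P2].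
by split; [exact: plot_comp oV sF VU P1 | exact: plot_comp oV sF VU P2].
Qed.

Program Definition sub_diffeology X (DX : diffeology R X) (A : X -> Prop) :
    diffeology R {x | A x} :=
  @Diffeology R {x | A x}
    (fun n U P => plot DX U (fun u => sval (P u))) _ _ _ _ _.
Next Obligation. by move=> X DX A n U P /plot_open. Qed.
Next Obligation.
by move=> X DX A n U P Q pP PQ; apply: plot_eq pP _ => u Uu; rewrite PQ.
Qed.
Next Obligation. by move=> X DX A n U x oU; exact: plot_cst. Qed.
Next Obligation. by move=> X DX A n U P; exact: plot_local. Qed.
Next Obligation.
by move=> X DX A m n V U F P oV sF VU pP; exact: plot_comp oV sF VU pP.
Qed.

Definition pushforward_diffeology X Y (DX : diffeology R X) (f : X -> Y) :
    diffeology R Y :=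
  finest_diffeology (fun D => smooth DX D f).

(* For a surjective [f], the plots of the pushforward diffeology are the
   parametrizations that locally lift along [f] to plots of [DX]. *)
Definition subduction X Y (DX : diffeology R X) (DY : diffeology R Y)
    (f : X -> Y) : Prop :=
  (forall y, exists x, f x = y) /\
  forall n (U : set 'rV[R]_n) P,
    plot DY U P <-> plot (pushforward_diffeology DX f) U P.

Definition quotient_diffeology d (I : zmodClosed 'rV[R]_d) :
    diffeology R (Quotient.quot I) :=
  pushforward_diffeology (std_diffeology d)
    (\pi_(Quotient.quot I)%qT : 'rV[R]_d -> Quotient.quot I).

Definition discrete_diffeology X (D : diffeology R X) : Prop :=
  forall n (U : set 'rV[R]_n) P,
    plot D U P <-> open U /\ forall u, U u -> \forall w \near u, P w = P u.

End diffeology_constructions.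

Section structure_groupoid.
Variables (R : realType) (X B : Type).
Variables (DX : diffeology R X) (DB : diffeology R B) (p : X -> B).

Definition fiber (b : B) := {x : X | p x = b}.

Definition fiber_diffeology (b : B) : diffeology R (fiber b) :=
  sub_diffeology DX (fun x => p x = b).

Record arrow := Arrow {
  source : B;
  target : B;
  arrow_map : fiber source -> fiber target;
  arrow_inv : fiber target -> fiber source;
  arrow_mapK : cancel arrow_map arrow_inv;
  arrow_invK : cancel arrow_inv arrow_map;
  arrow_map_smooth :
    smooth (fiber_diffeology source) (fiber_diffeology target) arrow_map;
  arrow_inv_smooth :
    smooth (fiber_diffeology target) (fiber_diffeology source) arrow_inv }.

Definition unit_arrow (b : B) : arrow :=
  @Arrow b b id id (fun=> erefl) (fun=> erefl)
    (fun _ _ _ => id) (fun _ _ _ => id).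

Definition inv_arrow (f : arrow) : arrow :=
  Arrow (@arrow_invK f) (@arrow_mapK f)
    (@arrow_inv_smooth f) (@arrow_map_smooth f).

Definition composable := {fg : arrow * arrow | target fg.1 = source fg.2}.

Definition fiber_cast b b' (e : b = b') (x : fiber b) : fiber b' :=
  exist _ (sval x) (etrans (svalP x) e).

Lemma fiber_castK b b' (e : b = b') (e' : b' = b) :
  cancel (fiber_cast e) (fiber_cast e').
Proof. by move=> [x xb]; exact: eq_exist. Qed.

Lemma fiber_cast_smooth b b' (e : b = b') :
  smooth (fiber_diffeology b) (fiber_diffeology b') (fiber_cast e).
Proof. by move=> n U P. Qed.

(* [comp_arrow (f, g)] is f followed by g. *)
Program Definition comp_arrow (fg : composable) : arrow :=
  let f := (sval fg).1 in let g := (sval fg).2 in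
  @Arrow (source f) (target g)
    (fun x => arrow_map (fiber_cast (svalP fg) (arrow_map x)))
    (fun y => arrow_inv (fiber_cast (esym (svalP fg)) (arrow_inv y)))
    _ _ _ _.
Next Obligation.
by move=> [[f g] /= e] x /=; rewrite arrow_mapK fiber_castK arrow_mapK.
Qed.
Next Obligation.
by move=> [[f g] /= e] y /=; rewrite arrow_invK fiber_castK arrow_invK.
Qed.
Next Obligation.
move=> [[f g] /= e] n U P pP; apply: (arrow_map_smooth (a := g)).
exact/fiber_cast_smooth/(arrow_map_smooth (a := f)).
Qed.
Next Obligation.
move=> [[f g] /= e] n U P pP; apply: (arrow_inv_smooth (a := f)).
exact/fiber_cast_smooth/(arrow_inv_smooth (a := g)).
Qed.

Definition groupoid_diffeology (D : diffeology R arrow) : Prop :=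
  [/\ smooth D DB source, smooth D DB target,
      smooth DB D unit_arrow, smooth D D inv_arrow &
      smooth (sub_diffeology (prod_diffeology D D)
        (fun fg => target fg.1 = source fg.2)) D comp_arrow].

Definition evaluation (fx : {fx : arrow * X | p fx.2 = source fx.1}) : X :=
  sval (arrow_map (exist _ (sval fx).2 (svalP fx))).

Definition smooth_evaluation (D : diffeology R arrow) : Prop :=
  smooth (sub_diffeology (prod_diffeology D DX)
    (fun fx => p fx.2 = source fx.1)) DX evaluation.

Definition characteristic (f : arrow) : B * B := (source f, target f).

(* [coarsest] determines the plots of [D], hence there is no choice in the
   existential quantification below. *)
Definition diffeological_fibration : Prop :=
  [/\ smooth DX DB p, forall b, exists x, p x = b &
      exists D : diffeology R arrow,
        coarsest (fun D => groupoid_diffeology D /\ smooth_evaluation D) D /\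
        subduction D (prod_diffeology DB DB) characteristic].

End structure_groupoid.

Definition covering_space (R : realType) (X B : Type) (DX : diffeology R X)
    (DB : diffeology R B) : Prop :=
  exists p : X -> B, diffeological_fibration DX DB p /\
    forall b, discrete_diffeology (fiber_diffeology DX p b).

Section tilings.
Variables (R : realType) (d : nat).
Local Notation E := 'rV[R]_d.
Implicit Types (t : set E) (T : set (set E)) (x v w : E).

Definition euclidean_norm x : R := Num.sqrt (\sum_(i < d) x 0 i ^+ 2).

Definition euclidean_ball x (r : R) : set E :=
  [set y | euclidean_norm (y - x) < r].

Definition homeomorphic (A B : set E) : Prop :=
  exists f g : E -> E,
    [/\ (forall x, A x -> B (f x)), (forall y, B y -> A (g y)),
        (forall x, A x -> g (f x) = x), (forall y, B y -> f (g y) = y) &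
        {within A, continuous f} /\ {within B, continuous g}].

Definition closed_disk (t : set E) : Prop :=
  homeomorphic [set x | euclidean_norm x <= 1] t.

Definition translate t x : set E := [set y + x | y in t].

Definition translate_tiling T x : set (set E) := [set translate t x | t in T].

(* A tiling is identified with its set of tiles. The family of tiles
   {t_1, t_2, ...} is countable, and each tiling has its own finite set of
   prototiles. *)
Record tiling T : Prop := {
  tiling_countable : countable T;
  tiling_closed : forall t, T t -> closed t;
  tiling_cover : \bigcup_(t in T) t = setT;
  tiling_disjoint : trivIset T (@interior E);
  tiling_prototiles : exists S : set (set E),
    [/\ finite_set S, forall s, S s -> closed_disk s &
        forall t, T t -> exists2 s, S s & exists x, t = translate s x] }.

(* Vertices are part of the data: each tile shape comes with a finite nonempty
   set of boundary points, transported along translations. *)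
Record vertex_map := VertexMap {
  vertices :> set E -> set E;
  vertices_translate : forall t x,
    vertices (translate t x) = translate (vertices t) x;
  vertices_finite : forall t, closed_disk t -> finite_set (vertices t);
  vertices_nonempty : forall t, closed_disk t -> vertices t !=set0;
  vertices_boundary : forall t, closed_disk t -> vertices t `<=` t `\` t° }.

Definition tiling_vertices (V : vertex_map) T : set E :=
  \bigcup_(t in T) V t.

(* A patch is given by its finite set of tiles, so that an occurrence of a
   translate of [P] in [T] is an occurrence tile by tile. *)
Definition patch T (P : set (set E)) : Prop :=
  [/\ finite_set P, P `<=` T & connected (\bigcup_(t in P) t)].

Definition repetitive T : Prop :=
  forall P, patch T P -> exists2 r : R, 0 < r & forall x, exists y,
    forall t, P t ->
      T (translate t y) /\ translate t y `<=` euclidean_ball x r.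

(* [T] and [T'] have the same tiles among those meeting [K]. *)
Definition coincide_on (K : set E) T T' : Prop :=
  forall t, t `&` K !=set0 -> (T t <-> T' t).

Definition close (e : R) T T' : Prop :=
  exists x x', [/\ euclidean_norm x < e / 2, euclidean_norm x' < e / 2 &
    coincide_on (euclidean_ball 0 e^-1)
      (translate_tiling T x) (translate_tiling T' x')].

Definition tilings_cauchy (s : nat -> set (set E)) : Prop :=
  forall e : R, 0 < e -> exists N, forall m n,
    (N <= m)%N -> (N <= n)%N -> close e (s m) (s n).

Definition tilings_cvg (s : nat -> set (set E)) T : Prop :=
  forall e : R, 0 < e -> exists N, forall n, (N <= n)%N -> close e (s n) T.

Record tiling_space := TilingSpace {
  tilings :> set (set E) -> Prop;
  tilings_tiling : forall T, tilings T -> tiling T;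
  tilings_translate : forall T x, tilings T -> tilings (translate_tiling T x);
  tilings_complete : forall s : nat -> set (set E), (forall n, tilings (s n)) ->
    tilings_cauchy s -> exists2 T, tilings T & tilings_cvg s T }.

Definition action (O : tiling_space) (xT : E * {T | O T}) : {T | O T} :=
  exist _ (translate_tiling (sval xT.2) xT.1)
    (tilings_translate xT.1 (svalP xT.2)).

Definition smooth_action (O : tiling_space) (D : diffeology R {T | O T}) : Prop :=
  smooth (prod_diffeology (std_diffeology R d) D) D (@action O).

Definition tiling_diffeology (O : tiling_space) : diffeology R {T | O T} :=
  finest_diffeology (@smooth_action O).

Lemma tiling_diffeology_finest (O : tiling_space) :
  finest (@smooth_action O) (tiling_diffeology O).
Proof.
split=> [n U P [pP [oU qP]]|D CD n U P [_ qP]]; last exact: qP.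
by split=> // D CD; apply: (CD n U P); split=> //; exact: qP.
Qed.

Definition return_vectors (V : vertex_map) T v : set E :=
  [set w | tiling_vertices V T (v + w)].

End tilings.

Section Zspan.
Variables (G : zmodType) (A : set G).

Definition Zspan : {pred G} :=
  fun x => `[< exists s : seq (int * G),
    (forall c, c \in s -> A c.2) /\ x = \sum_(c <- s) c.2 *~ c.1 >].

Lemma Zspan_zmod_closed : zmod_closed Zspan.
Proof.
split=> [|x y]; first by apply/asboolP; exists [::]; rewrite big_nil.
move=> /asboolP[s [As ->]] /asboolP[r [Ar ->]]; apply/asboolP.
exists (s ++ [seq (- c.1, c.2) | c <- r]); split=> [c|].
  by rewrite mem_cat => /orP[/As //|/mapP[c' /Ar ? ->]].
rewrite big_cat big_map -sumrN; congr (_ + _).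
by apply: eq_bigr => c _; rewrite mulrNz.
Qed.

HB.instance Definition _ :=
  GRing.isZmodClosed.Build G Zspan Zspan_zmod_closed.

End Zspan.

Definition return_module (R : realType) (d : nat) (V : vertex_map R d)
    (T : set (set 'rV[R]_d)) (v : 'rV[R]_d) : zmodClosed 'rV[R]_d :=
  Zspan (return_vectors V T v).

(* Main.v *)
From HB Require Import structures.
Require Import Defs.
From mathcomp Require Import all_boot all_order all_algebra.
From mathcomp Require Import lra.
From mathcomp Require Import all_classical all_reals all_analysis.
Set Implicit Arguments.
Unset Strict Implicit.
Unset Printing Implicit Defensive.
Import Order.TTheory GRing.Theory Num.Theory.
Import numFieldNormedType.Exports.
Local Open Scope classical_set_scope.
Local Open Scope ring_scope.

(* The plots of Omega are locally of the form S + Q(u) with Q smooth, so Omega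
   is diffeologically the disjoint union of its orbits, that of S being R^d
   modulo the stabilizer of S. By Baire's theorem some tile has an interior
   point, hence stabilizers are discrete; the vertices of T are relatively
   dense, hence R_v spans R^d. For each orbit there is thus an invertible matrix
   A mapping the stabilizer into R_v, and S + x |-> [x A] is well defined on it;
   different orbits may need different A, because Omega need not be minimal.
   Letting y act on the orbit by translation by y A^-1 gives a smooth action of
   R^d on Omega which lifts the translations of R^d / R_v. It provides
   diffeomorphisms between the fibers that depend smoothly on their end points,
   i.e. local lifts along the characteristic map. The fibers are discrete
   because R_v is countable: a continuous map with countably many values is
   locally constant. *)

(** * Continuous and smooth maps *)

Section row_norm.
Variable R : realType.

Lemma ler_coord_norm n (x : 'rV[R]_n) i : `|x 0 i| <= `|x|.
Proof.
rewrite [leRHS]/Num.norm /= mx_normrE; apply/bigmax_geP; right => /=.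
by exists (0, i).
Qed.

Lemma ltr_norm_coord n (x : 'rV[R]_n) e :
  0 < e -> (forall i, `|x 0 i| < e) -> `|x| < e.
Proof.
move=> e0 xe; rewrite [ltLHS]/Num.norm /= mx_normrE; apply/bigmax_ltP; split=> //.
by move=> [i j] _ /=; rewrite (ord1 i).
Qed.

Lemma mulmxr_continuous n p (A : 'M[R]_(n, p)) :
  continuous (fun x : 'rV[R]_n => x *m A).
Proof.
have -> : (fun x : 'rV[R]_n => x *m A) = fun x => \sum_i x 0 i *: row i A.
  by apply/funext => y; rewrite mulmx_sum_row.
apply: continuous_big => [|i _ x]; first exact: add_continuous.
exact: cvgZr_tmp (@coord_continuous _ _ _ 0 i x).
Qed.

Lemma smooth_on_mulmx n p q U (A : 'M[R]_(p, q)) (f : 'rV[R]_n -> 'rV[R]_p) :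
  open U -> smooth_on U f -> smooth_on U (fun x => f x *m A).
Proof.
move=> oU sf k.
exact: (Ck_linear (L := mulmxr A) oU (@mulmxr_continuous _ _ A) (sf k)).
Qed.

Lemma smooth_onD n (W : normedModType R) U (f g : 'rV[R]_n -> W) :
  open U -> smooth_on U f -> smooth_on U g -> smooth_on U (fun x => f x + g x).
Proof. by move=> oU sf sg k; exact: CkD. Qed.

Lemma smooth_on_cst n (W : normedModType R) U (a : W) :
  open U -> smooth_on U (fun=> a : W) (n := n).
Proof. by move=> oU k; exact: Ck_cst. Qed.

Lemma smooth_onN n p U (f : 'rV[R]_n -> 'rV[R]_p) :
  open U -> smooth_on U f -> smooth_on U (fun x => - f x).
Proof.
move=> oU sf; have -> : (fun x => - f x) = fun x => f x *m (- 1%:M).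
  by apply/funext => x; rewrite mulmxN mulmx1.
exact: smooth_on_mulmx.
Qed.

Lemma smooth_on_id n (U : set 'rV[R]_n) : open U -> smooth_on U id.
Proof.
move=> oU [|k] /=; first by move=> x _; exact: cvg_id.
pose L : {linear 'rV[R]_n -> 'rV[R]_n} := idfun.
have cL : continuous L by move=> x; exact: cvg_id.
split=> [x _|v]; first exact: (linear_differentiable (f := L)).
by apply: (eq_Ck oU _ (Ck_cst oU k v)) => x _; rewrite (diff_lin (f := L)).
Qed.

Lemma smooth_on_continuous n (W : normedModType R) U (f : 'rV[R]_n -> W) x :
  smooth_on U f -> U x -> {for x, continuous f}.
Proof. by move=> /(_ 0) /=; exact. Qed.

(** A nondegenerate interval has positive Lebesgue measure, whereas a countable set is null. *)
Lemma countable_interval_le (C : set R) (a b : R) :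
  countable C -> `[a, b]%classic `<=` C -> b <= a.
Proof.
move=> cC abC; rewrite leNgt; apply/negP => ab.
have cab : countable (`[a, b]%classic : set R).
  exact: sub_countable (subset_card_le abC) cC.
have := countable_lebesgue_measure0 cab.
rewrite lebesgue_measure_itv /= lte_fin ab -EFinD => -[] /eqP.
by rewrite subr_eq0 gt_eqF.
Qed.

(** By the intermediate value theorem [C] contains the whole interval between [f a] and [f b], which
    must therefore be degenerate. *)
Lemma continuous_countable_eq (C : set R) (f : R -> R) (a b : R) :
  countable C -> a <= b -> {within `[a, b], continuous f} ->
  (forall t, t \in `[a, b] -> C (f t)) -> f a = f b.
Proof.
move=> cC ab cf fC.
have sub : `[Num.min (f a) (f b), Num.max (f a) (f b)]%classic `<=` C.
  by move=> y /=; rewrite in_itv /= => /(IVT ab cf)[c /fC Cfc <-].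
have := countable_interval_le cC sub.
case: (leP (f a) (f b)) => fab H; apply/eqP; rewrite eq_le.
  by rewrite fab.
by rewrite H ltW.
Qed.

(** On a ball around [u] inside [U], each coordinate of [f] is restricted to the segment from [u] to
    [w]; this reduces to one real variable. *)
Lemma continuous_countable_locally_cst n p (U : set 'rV[R]_n)
    (f : 'rV[R]_n -> 'rV[R]_p) (C : set 'rV[R]_p) u :
  open U -> U u -> (forall w, U w -> {for w, continuous f}) ->
  countable C -> (forall w, U w -> C (f w)) -> \forall w \near u, f w = f u.
Proof.
move=> oU Uu cf cC fC.
have /nbhs_ballP[e /= e0 eU] := open_nbhs_nbhs (conj oU Uu).
apply/nbhs_ballP; exists e => //= w uw; apply/rowP => j.
pose g (t : R) := f (u + t *: (w - u)) 0 j.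
have segU t : t \in `[0, 1] -> U (u + t *: (w - u)).
  rewrite in_itv /= => /andP[t0 t1]; apply: eU.
  rewrite mx_norm_ball /ball_ /= opprD addrA subrr add0r normrN normrZ.
  rewrite ger0_norm// -normrN opprB; move: uw; rewrite mx_norm_ball /ball_ /=.
  by apply: le_lt_trans; rewrite ler_piMl.
have <- : g 0 = f u 0 j by rewrite /g scale0r addr0.
have <- : g 1 = f w 0 j by rewrite /g scale1r addrC subrK.
apply/esym; apply: (@continuous_countable_eq [set x 0 j | x in C]) => //.
- exact: sub_countable (card_image_le _ _) cC.
- apply: continuous_in_subspaceT => t /set_mem /= /segU Ut.
  apply: (@continuous_comp _ _ _ (fun t : R => f (u + t *: (w - u)))
     (fun x : 'rV[R]_p => x 0 j)); last exact: coord_continuous.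
  apply: (@continuous_comp _ _ _ (fun t : R => u + t *: (w - u)) f); last exact: cf.
  by apply: cvgD; [exact: cvg_cst|apply: cvgZr_tmp; exact: cvg_id].
- by move=> t /segU /fC Cf; exists (f (u + t *: (w - u))).
Qed.

End row_norm.

(** * Discrete and cobounded subgroups of R^d *)

Section lattices.

(** Cramer's rule: the cofactors along row [i] do not see that row, so the new determinant is
    [\det B] times the [i]-th coordinate of [x] in the basis [B]. *)
Lemma replace_row_unitmx (F : fieldType) n (B : 'M[F]_n) (x : 'rV_n) i :
  B \in unitmx -> (x *m invmx B) 0 i != 0 ->
  (\matrix_k (if k == i then x else row k B)) \in unitmx.
Proof.
move=> uB xi; rewrite unitmxE unitfE (expand_det_row _ i).
set B' := \matrix_k _.
have cofE j : cofactor B' i j = cofactor B i j.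
  rewrite /cofactor; congr (_ * \det _); apply/matrixP => a b.
  by rewrite !mxE eq_sym (negbTE (neq_lift _ _)) mxE.
rewrite (_ : \sum_j _ = (x *m \adj B) 0 i); last first.
  by rewrite mxE; apply: eq_bigr => j _; rewrite cofE !mxE eqxx.
apply: contra_neq xi => xi0; rewrite /invmx uB -scalemxAr mxE xi0.
by rewrite mulr0.
Qed.

(* Any matrix with the largest number of rows in [S] will do. *)
Lemma unitmx_max_rows (F : fieldType) n (S : {pred 'rV[F]_n}) :
  exists2 B : 'M[F]_n, B \in unitmx &
    forall x i, x \in S -> row i B \notin S -> (x *m invmx B) 0 i = 0.
Proof.
pose P k := `[< exists2 B : 'M[F]_n, B \in unitmx &
  #|[set i | row i B \in S]%SET| = k >].
have exP : exists k, P k.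
  exists #|[set i | row i (1%:M : 'M[F]_n) \in S]%SET|; apply/asboolP.
  by exists 1%:M => //; exact: unitmx1.
have ubP k : P k -> (k <= n)%N.
  by move=> /asboolP[B _ <-]; rewrite -[leqRHS]card_ord max_card.
case: (ex_maxnP exP ubP) => k /asboolP[B uB <-] maxB; exists B => // x i xS BiS.
(* Otherwise replacing row [i] by [x] keeps the matrix invertible and gives it one more row in
   [S]. *)
apply: contrapT => /eqP xi.
set B' := \matrix_k (if k == i then x else row k B).
have /maxB : P #|[set j | row j B' \in S]%SET|.
  by apply/asboolP; exists B' => //; exact: replace_row_unitmx.
rewrite leqNgt => /negP; apply; apply: proper_card; apply/properP; split.
  apply/fintype.subsetP => j; rewrite !finset.in_set => jS.
  by rewrite rowK; case: eqP.
exists i; first by rewrite finset.in_set rowK eqxx.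
by rewrite finset.in_set.
Qed.

Variables (R : realType) (d : nat).
Implicit Types G I : zmodClosed 'rV[R]_d.

(* Pigeonhole: among the fractional parts of the first m + 1 multiples of the
   coordinates two lie in the same of m small cells, so they agree by discreteness; this
   gives the denominator m!, the same for all [x]. *)
Lemma discrete_coord_rational G (e : R) :
  0 < e -> (forall x, x \in G -> `|x| < e -> x = 0) ->
  exists2 B : 'M[R]_d, B \in unitmx & exists2 N : nat, (0 < N)%N &
    forall x i, x \in G -> N%:R * (x *m invmx B) 0 i \is a Num.int.
Proof.
move=> e0 Ge; have [B uB Bmax] := unitmx_max_rows (mem G).
exists B => //.
(* By continuity at 0, coordinates below [1 / (k + 1)] give a vector shorter than [e]; this fixes
   the side of the cells, and [m] below is their number in the unit cube. *)
have [k kP] : exists k : nat, forall c : 'rV[R]_d,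
    (forall i, `|c 0 i| < k.+1%:R^-1) -> `|c *m B| < e.
  have := @mulmxr_continuous R d d B 0; rewrite /continuous_at mul0mx.
  move=> /cvgrPdist_lt/(_ e e0)/nbhs_ballP[/= f f0 fe].
  exists (Num.truncn f^-1) => c cf; rewrite -normrN -sub0r; apply: fe.
  rewrite mx_norm_ball /ball_ /= sub0r normrN; apply: ltr_norm_coord => // i.
  apply: lt_trans (cf i) _; rewrite -[ltRHS]invrK ltf_pV2 ?posrE ?invr_gt0//.
  exact: truncnS_gt.
set m := #|{ffun 'I_d -> 'I_k.+1}|.
exists m`!; first exact: fact_gt0.
move=> x i xG; set c := x *m invmx B.
have xE : x = c *m B by rewrite mulmxKV.
pose fr (j : nat) : 'rV[R]_d :=
  \row_i (j%:R * c 0 i - (Num.floor (j%:R * c 0 i))%:~R).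
have fr_itv j l : 0 <= fr j 0 l < 1.
  rewrite mxE; have := floor_itv (j%:R * c 0 l).
  by rewrite subr_ge0 ltrBlDl intrD => /andP[-> ->].
have frG j : fr j *m B \in G.
  rewrite (_ : fr j *m B =
    j%:R *: x - \sum_l (Num.floor (j%:R * c 0 l))%:~R *: row l B); last first.
    rewrite {1}xE scalemxAl !mulmx_sum_row -sumrB; apply: eq_bigr => l _.
    by rewrite !mxE scalerBl.
  rewrite rpredB//; first by rewrite scaler_nat rpredMn.
  (* A row outside [G] contributes nothing, as the coordinate of [x] along it vanishes by the choice
     of [B]. *)
  apply: rpred_sum => l _; have [lG|lG] := boolP (row l B \in G).
    by rewrite rpredZint.
  by rewrite /c (Bmax x l xG lG) mulr0 floor0 scale0r rpred0.
pose cell (j : 'I_m.+1) : {ffun 'I_d -> 'I_k.+1} :=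
  [ffun l => inord (Num.truncn (k.+1%:R * fr j 0 l))].
have [j1 [j2 [j12 cellE]]] : exists j1 j2 : 'I_m.+1,
    (j1 < j2)%N /\ cell j1 = cell j2.
  apply: contrapT => nex.
  have /leq_card : injective cell.
    move=> j1 j2 cE; apply/val_inj => /=.
    by case: (ltngtP j1 j2) => // lt; exfalso; apply: nex;
      [exists j1, j2|exists j2, j1].
  by rewrite card_ord ltnn.
have frE : fr j1 = fr j2.
  suff : (fr j1 - fr j2) *m B = 0.
    move=> /(congr1 (mulmx^~ (invmx B))); rewrite mulmxK// mul0mx.
    by move/eqP; rewrite subr_eq0 => /eqP.
  apply: Ge; first by rewrite mulmxBl rpredB.
  apply: kP => l.
  move: cellE => /ffunP/(_ l); rewrite !ffunE => /(congr1 val) /=.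
  have trP j : let t := Num.truncn (k.+1%:R * fr j 0 l) in
      (t < k.+1)%N /\ t%:R <= k.+1%:R * fr j 0 l < t.+1%:R.
    have /andP[f0 f1] := fr_itv j l.
    split; last by apply: truncn_itv; rewrite mulr_ge0.
    by rewrite truncn_lt_nat ?mulr_ge0// gtr_pMr.
  have [t1 i1] := trP j1; have [t2 i2] := trP j2.
  rewrite !inordK// => tE; move: i1 i2; rewrite tE !mxE.
  set u := fr j1 0 l; set w := fr j2 0 l; set t := Num.truncn _.
  move=> /andP[u1 u2] /andP[w1 w2].
  rewrite -(ltr_pM2l (ltr0Sn R k)) mulfV ?pnatr_eq0//.
  rewrite -[X in X * _](ger0_norm (ler0n R k.+1)) -normrM mulrBr.
  rewrite ltr_distl; apply/andP; split.
    rewrite ltrBlDr; apply: lt_le_trans w2 _.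
    by rewrite -natr1 lerD2r.
  by apply: lt_le_trans u2 _; rewrite -natr1 lerD2r.
have dj : ((j2 - j1) %| m`!)%N.
  rewrite dvdn_fact// subn_gt0 j12 /=.
  by rewrite (leq_trans (leq_subr _ _))// -ltnS.
rewrite -(divnK dj) natrM -mulrA rpredM ?natr_int//.
rewrite natrB 1?ltnW// mulrBl.
have := congr1 (fun f : 'rV[R]_d => f 0 i) frE; rewrite !mxE => jE.
set a1 := _ * _ in jE *; set a2 := _ * _ in jE *.
(* Equal fractional parts turn the multiple [j2 - j1] of the coordinate into a difference of two
   floors. *)
suff -> : a2 - a1 = (Num.floor a2)%:~R - (Num.floor a1)%:~R.
  by rewrite rpredB// intr_int.
by lra.
Qed.

(* A proper subspace misses points at arbitrarily large distance. *)
Lemma cobounded_unitmx I (r : R) :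
  (forall x, exists2 w, w \in I & `|x - w| <= r) ->
  exists2 B : 'M[R]_d, B \in unitmx & forall i, row i B \in I.
Proof.
move=> Ir; have [B uB Bmax] := unitmx_max_rows (mem I).
exists B => // i; apply: contrapT => /negP BiI.
(* [M] bounds the [i]-th coordinate in the basis [B] of any vector of norm at most [r]. Elements of
   [I] have [i]-th coordinate 0, so [M + 1] times row [i] is too far from all of them. *)
pose M := \sum_j r * `|invmx B j i|.
have [w wI wr] := Ir ((M + 1) *: row i B).
have : `|(((M + 1) *: row i B - w) *m invmx B) 0 i| <= M.
  rewrite mxE; apply: le_trans (ler_norm_sum _ _ _) _; apply: ler_sum => j _.
  by rewrite normrM ler_wpM2r//; apply: le_trans wr; exact: ler_coord_norm.
have := Bmax w i wI BiI; rewrite mulmxBl -scalemxAl -row_mul mulmxV//.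
move: (w *m _) => u u0; rewrite !mxE u0 eqxx mulr1 subr0.
by move=> /(le_trans (ler_norm _)); rewrite gerDl ler10.
Qed.

(** Coordinates of elements of [G] in a suitable basis become integers after multiplication by a
    common [N]; they then serve as coefficients on a basis [Q] of R^d taken from [I]. *)
Lemma discrete_embedding G I (e r : R) :
  0 < e -> (forall x, x \in G -> `|x| < e -> x = 0) ->
  (forall x, exists2 w, w \in I & `|x - w| <= r) ->
  exists2 A : 'M[R]_d, A \in unitmx & forall x, x \in G -> x *m A \in I.
Proof.
move=> e0 Ge /cobounded_unitmx[Q uQ QI].
have [B uB [N N0 BN]] := discrete_coord_rational e0 Ge.
exists (N%:R *: (invmx B *m Q)).
  by rewrite unitmxZ ?unitmx_mul ?unitmx_inv ?uB// unitfE pnatr_eq0 -lt0n.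
move=> x xG; rewrite -scalemxAr mulmxA mulmx_sum_row scaler_sumr.
by apply: rpred_sum => i _; rewrite scalerA rpredZ_int//; exact: BN.
Qed.

End lattices.

(** * Tilings *)

Section Zspan_theory.
Variable G : zmodType.
Implicit Types A P : set G.

Lemma Zspan_sub A x : A x -> x \in Zspan A.
Proof.
move=> Ax; apply/asboolP; exists [:: (1, x)]; split=> [c|].
  by rewrite inE => /eqP ->.
by rewrite big_seq1 mulr1z.
Qed.

Lemma Zspan_min A P : P 0 -> (forall x y, P x -> P y -> P (x - y)) ->
  A `<=` P -> forall x, x \in Zspan A -> P x.
Proof.
move=> P0 PB AP x /asboolP[s [As ->]].
have PN y : P y -> P (- y) by rewrite -sub0r; exact: PB.
have PD y z : P y -> P z -> P (y + z) by move=> Py /PN; rewrite -{2}(opprK z); exact: PB.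
rewrite big_seq; elim/big_ind : _ => // c /As/AP Pc.
have Pn n : P (c.2 *+ n) by elim: n => // n IH; rewrite mulrS; exact: PD.
by case: c.1 => n; [exact: Pn|exact/PN/Pn].
Qed.

(** Once [A] is numbered by [f], each element of the span is the value of [h] at a finite list of
    pairs in [int * nat], and such lists are countable. *)
Lemma countable_Zspan A : countable A -> countable [set x | x \in Zspan A].
Proof.
move=> /countable_injP[f finj].
pose g (n : nat) := xget (0 : G) [set x | A x /\ f x = n].
have fK x : A x -> g (f x) = x.
  move=> Ax; have [Ag fg] : A (g (f x)) /\ f (g (f x)) = f x.
    exact: (@xgetPex _ 0 [set y | A y /\ f y = f x] (ex_intro _ x (conj Ax erefl))).
  by apply: finj; rewrite ?inE.
pose h (s : seq (int * nat)) := \sum_(c <- s) g c.2 *~ c.1.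
apply: (@sub_countable _ _ _ (h @` setT)).
  apply: subset_card_le => x /= /asboolP[s [As ->]].
  exists [seq (c.1, f c.2) | c <- s] => //; rewrite /h big_map.
  by rewrite big_seq [RHS]big_seq; apply: eq_bigr => c /As /fK ->.
exact: sub_countable (card_image_le _ _) (countableP _).
Qed.

End Zspan_theory.

(** Makes R^d a complete normed space, as Baire's theorem requires. *)
HB.instance Definition _ (R : realType) (m n : nat) :=
  Uniform_isComplete.Build 'M[R]_(m, n) cauchy_cvg.

(** * Translations, stabilizers and vertices of tilings *)

Section translations.
Variables (R : realType) (d : nat).
Implicit Types (t : set 'rV[R]_d) (T : set (set 'rV[R]_d)) (x y : 'rV[R]_d).

Lemma translateE t x y : translate t x y = t (y - x).
Proof.
apply/propext; split=> [[z tz <-]|tyx]; first by rewrite addrK.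
by exists (y - x) => //; rewrite subrK.
Qed.

Lemma translate0 t : translate t 0 = t.
Proof. by apply/funext => y; rewrite translateE subr0. Qed.

Lemma translateD t x y : translate t (x + y) = translate (translate t x) y.
Proof. by apply/funext => z; rewrite !translateE opprD addrCA addrC. Qed.

Lemma translate_tiling0 T : translate_tiling T 0 = T.
Proof.
rewrite predeqE => t; split=> [[s Ts <-]|Tt]; first by rewrite translate0.
by exists t => //; rewrite translate0.
Qed.

Lemma translate_tilingD T x y :
  translate_tiling T (x + y) = translate_tiling (translate_tiling T x) y.
Proof.
rewrite predeqE => t; split=> [[s Ts <-]|[_ [s Ts <-] <-]].
  by exists (translate s x); [exists s|rewrite translateD].
by exists s => //; rewrite translateD.
Qed.

Lemma translate_tiling_inj x : injective (fun T => translate_tiling T x).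
Proof.
move=> T T' /(congr1 (fun S => translate_tiling S (- x))).
by rewrite -!translate_tilingD subrr !translate_tiling0.
Qed.

Definition stabilizer T := [set x | translate_tiling T x = T].

(** The stabilizer is already a subgroup; passing to its span only supplies the [zmodClosed]
    structure that the lattice lemmas expect. *)
Lemma Zspan_stabilizer T x : x \in Zspan (stabilizer T) -> translate_tiling T x = T.
Proof.
apply: (@Zspan_min _ _ (stabilizer T)) => // [|y z Ty Tz].
  exact: translate_tiling0.
by apply: (@translate_tiling_inj z); rewrite -translate_tilingD subrK Ty Tz.
Qed.

Lemma ler_coord_euclidean_norm x i : `|x 0 i| <= euclidean_norm x.
Proof.
rewrite -sqrtr_sqr ler_wsqrtr// (bigD1 i)//= lerDl.
by apply: sumr_ge0 => j _; exact: sqr_ge0.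
Qed.

Lemma compact_unit_disk : compact [set x : 'rV[R]_d | euclidean_norm x <= 1].
Proof.
apply: bounded_closed_compact.
  exists 1; split=> // M M1 x /= x1; apply: ltW.
  apply: ltr_norm_coord => [|i]; first exact: lt_trans M1.
  exact: le_lt_trans (le_trans (ler_coord_euclidean_norm x i) x1) M1.
have cn : continuous (@euclidean_norm R d).
  move=> x; apply: (@continuous_comp _ _ _ (fun x : 'rV[R]_d => \sum_i x 0 i ^+ 2)
    Num.sqrt); last exact: sqrt_continuous.
  move: x; apply: continuous_big => [|i _ x]; first exact: add_continuous.
  rewrite /continuous_at expr2; under eq_cvg do rewrite expr2.
  have cx := @coord_continuous R 1 d 0 i x.
  exact: (cvgM cx cx).
apply: (@preimage_closed _ _ (@euclidean_norm R d) [set y | y <= 1]) => //.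
Qed.

Lemma closed_disk_bounded t : closed_disk t ->
  exists M : R, forall x, t x -> `|x| <= M.
Proof.
move=> [f [g [ft tg _ fg [cf _]]]].
have [M [_ HM]] := compact_bounded (continuous_compact cf compact_unit_disk).
exists (M + 1) => x tx; apply: (HM (M + 1)); first by rewrite ltrDl.
by exists (g x); [exact: tg|exact: fg].
Qed.

Lemma prototiles_bounded (S : set (set 'rV[R]_d)) :
  finite_set S -> (forall s, S s -> closed_disk s) ->
  exists M : R, forall s x, S s -> s x -> `|x| <= M.
Proof.
move=> /finite_seqP[l ->] Sd.
have {Sd} : forall s, s \in l -> exists M : R, forall x, s x -> `|x| <= M.
  by move=> s /Sd /closed_disk_bounded.
elim: l => [|s l IH] lb; first by exists 0.
have [M1 M1P] := lb s (mem_head _ _).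
have [a al|M2 M2P] := IH; first by apply: lb; rewrite inE al orbT.
exists (Num.max M1 M2) => a x /=; rewrite inE => /orP[/eqP -> sx|al ax].
  by rewrite le_max M1P.
by rewrite le_max (M2P a x)// orbT.
Qed.

Lemma tile_bounded T : tiling T -> forall t, T t ->
  exists M : R, forall x, t x -> `|x| <= M.
Proof.
move=> [_ _ _ _ [S [Sfin Sd TS]]] _ /TS[s Ss [y ->]].
have [M MP] := closed_disk_bounded (Sd s Ss).
exists (M + `|y|) => x; rewrite translateE => /MP xyM.
by rewrite -[x in leLHS](subrK y) (le_trans (ler_normD _ _))// lerD2r.
Qed.

(* Baire's theorem on the countable closed cover avoids invariance of domain. *)
Lemma tile_interior T : tiling T -> exists2 t, T t & t° !=set0.
Proof.
move=> [cT clT covT _ _]; apply: contrapT => noint.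
have [f finj] := elimT (countable_injP T) cT.
(* [F n] is the complement of the tile numbered [n], or the whole space if there is none. *)
pose F n := [set x | forall t, T t -> f t = n -> ~ t x].
have odF : forall n, open (F n) /\ dense (F n).
  move=> n; have [[t [Tt ftn]]|nt] := pselect (exists t, T t /\ f t = n).
    have -> : F n = ~` t.
      rewrite predeqE => x; split=> [/(_ t Tt ftn)//|ntx s Ts fsn].
      have -> : s = t by apply: finj; rewrite ?in_setE// fsn.
      exact: ntx.
    split; first by apply: closed_openC; exact: clT.
    move=> O O0 oO; apply: contrapT => OC; apply: noint; exists t => //.
    (* A nonempty open set that misses the complement of [t] lies in [t] and provides an interior
       point. *)
    have Ot : O `<=` t.
      by move=> x Ox; apply: contrapT => tx; apply: OC; exists x.
    have [x Ox] := O0; exists x; exact: (filterS Ot (open_nbhs_nbhs (conj oO Ox))).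
  have -> : F n = setT.
    by rewrite predeqE => x; split=> // _ t Tt ftn; case: nt; exists t.
  split; first exact: openT.
  by move=> O [x Ox] _; exists x.
have [x [_ Fx]] := @Baire R 'rV[R]_d F odF _ (ex_intro setT 0 I) openT.
have [t Tt tx] : (\bigcup_(t in T) t) x by rewrite covT.
exact: Fx tx.
Qed.

(** A short stabilizing vector [x] moves a tile with interior so little that the interiors of the
    tile and its image meet, so the tile is preserved. It then contains [a + x *+ n] for all [n],
    and being bounded it forces [x = 0]. *)
Lemma stabilizer_discrete T : tiling T ->
  exists2 e : R, 0 < e & forall x, x \in Zspan (stabilizer T) -> `|x| < e -> x = 0.
Proof.
move=> tT; have [t Tt [a]] := tile_interior tT.
rewrite /interior /= => /nbhs_ballP[e /= e0 aet].
exists (e / 2); first exact: divr_gt0.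
move=> x /Zspan_stabilizer Tx xe.
have tx : translate t x = t.
  have Ttx : T (translate t x) by rewrite -Tx; exists t.
  apply: (tiling_disjoint tT) => //; exists a; split; last first.
    by apply/nbhs_ballP; exists e.
  apply/nbhs_ballP; exists (e / 2) => /=; first exact: divr_gt0.
  move=> y; rewrite mx_norm_ball /ball_ /= translateE => aye; apply: aet.
  rewrite mx_norm_ball /ball_ /= opprB addrA addrAC (splitr e).
  by rewrite (le_lt_trans (ler_normD _ _))// ltrD.
have ta n : t (a + x *+ n).
  elim: n => [|n IH]; first by rewrite mulr0n addr0; exact: (aet a (ballxx a e0)).
  by rewrite -tx translateE mulrSr addrA addrK.
have [M MP] := tile_bounded tT Tt.
have Mn n : `|x| *+ n <= M + `|a|.
  rewrite -normrMn -[x *+ n](addKr a) (le_trans (ler_normD _ _))//.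
  by rewrite normrN addrC lerD2r MP.
apply/eqP; rewrite -normr_le0 leNgt; apply/negP => x0.
have := truncnS_gt ((M + `|a|) / `|x|).
by rewrite ltr_pdivrMr// mulrC mulr_natr ltNge Mn.
Qed.

(** Every point lies in a tile, every tile contains a vertex, and the finitely many prototiles bound
    the diameters uniformly. *)
Lemma tiling_vertices_cobounded (V : vertex_map R d) T : tiling T ->
  exists r : R, forall x, exists2 y, tiling_vertices V T y & `|x - y| <= r.
Proof.
move=> [_ _ covT _ [S [Sfin Sd TS]]].
have [M MP] := prototiles_bounded Sfin Sd.
exists (M + M) => x.
have [t Tt tx] : (\bigcup_(t in T) t) x by rewrite covT.
have [s Ss [z tE]] := TS t Tt.
have [b Vb] := vertices_nonempty V (Sd s Ss).
have [sb _] := vertices_boundary (Sd s Ss) Vb.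
exists (b + z); first by exists t => //; rewrite tE vertices_translate; exists b.
move: tx; rewrite tE translateE => /(MP _ _ Ss) xzM.
by rewrite opprD addrCA addrC (le_trans (ler_normB _ _))// lerD// (MP s).
Qed.

Lemma countable_tiling_vertices (V : vertex_map R d) T : tiling T ->
  countable (tiling_vertices V T).
Proof.
move=> [cT _ _ _ [S [_ Sd TS]]]; apply: bigcup_countable => // t /TS[s Ss [z ->]].
rewrite vertices_translate; apply/finite_set_countable/finite_image.
exact: vertices_finite (Sd s Ss).
Qed.

Lemma return_module_cobounded (V : vertex_map R d) T v : tiling T ->
  exists r : R, forall x, exists2 w, w \in return_module V T v & `|x - w| <= r.
Proof.
move=> /(tiling_vertices_cobounded V)[r rP]; exists r => x.
have [y Vy xy] := rP (x + v); exists (y - v).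
  by apply: Zspan_sub; rewrite /return_vectors /= addrC subrK.
by rewrite opprB addrA.
Qed.

Lemma countable_return_module (V : vertex_map R d) T v : tiling T ->
  countable [set w | w \in return_module V T v].
Proof.
move=> /(countable_tiling_vertices V) cV; apply: countable_Zspan.
apply: (@sub_countable _ _ _ [set y - v | y in tiling_vertices V T]).
  apply: subset_card_le => w Vw; exists (v + w) => //.
  by rewrite addrC addKr.
exact: sub_countable (card_image_le _ _) cV.
Qed.

End translations.

(** * Diffeologies *)

Section diffeology_theory.
Variable R : realType.

Lemma plot_sub X (D : diffeology R X) n (U V : set 'rV[R]_n) P :
  open V -> V `<=` U -> plot D U P -> plot D V P.
Proof. by move=> oV VU; exact: (plot_comp oV (smooth_on_id oV)). Qed.

Lemma plot_set0 X (D : diffeology R X) n (U : set 'rV[R]_n) P :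
  open U -> ~ (exists u, U u) -> plot D U P.
Proof. by move=> oU U0; apply: plot_local => // u Uu; case: U0; exists u. Qed.

Lemma open_smooth_preimage m n (V : set 'rV[R]_m) (W : set 'rV[R]_n) F :
  open V -> open W -> smooth_on V F -> open (V `&` F @^-1` W).
Proof.
move=> oV oW sF; rewrite openE => v [Vv Wv].
have nV : nbhs v V by exact: open_nbhs_nbhs.
have nW : nbhs v (F @^-1` W).
  by apply: (smooth_on_continuous sF Vv); exact: open_nbhs_nbhs.
exact: filterI nV nW.
Qed.

Lemma smooth_on_comp l m n (V : set 'rV[R]_l) (U : set 'rV[R]_m)
    (F : 'rV[R]_l -> 'rV[R]_m) (G : 'rV[R]_m -> 'rV[R]_n) :
  open V -> (forall v, V v -> U (F v)) -> smooth_on V F -> smooth_on U G ->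
  smooth_on V (G \o F).
Proof. by move=> oV VU sF sG k; exact: (Ck_comp oV VU (sF k) (sG k)). Qed.

Lemma smooth_on_sub m n (U V : set 'rV[R]_m) (F : 'rV[R]_m -> 'rV[R]_n) :
  open V -> V `<=` U -> smooth_on U F -> smooth_on V F.
Proof. by move=> oV VU sF; exact: smooth_on_comp oV VU (smooth_on_id oV) sF. Qed.

(** Transfers smoothness from the subtype to total maps: [P] is lifted to [{x | A x}], a value taken
    on [U] serving as default outside. *)
Lemma plot_smooth_sub X Y (DX : diffeology R X) (DY : diffeology R Y)
    (A : X -> Prop) (f : {x | A x} -> Y) (g : X -> Y) n (U : set 'rV[R]_n) P :
  smooth (sub_diffeology DX A) DY f -> (forall x, f x = g (sval x)) ->
  plot DX U P -> (forall u, U u -> A (P u)) -> plot DY U (g \o P).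
Proof.
move=> sf fg pP PA; have oU := plot_open pP.
have [[u0 Uu0]|U0] := pselect (exists u, U u); last exact: plot_set0.
pose Q u : {x | A x} :=
  if pselect (A (P u)) is left e then exist _ (P u) e else exist _ (P u0) (PA _ Uu0).
have QP u : U u -> sval (Q u) = P u.
  by move=> /PA PuA; rewrite /Q; case: pselect.
have pQ : plot (sub_diffeology DX A) U Q.
  by apply: plot_eq pP _ => u /QP.
by apply: plot_eq (sf _ _ _ pQ) _ => u /QP /= <-.
Qed.

(** * The diffeology generated by a family of maps *)

Section final_diffeology.
Variables (I X Y : Type) (DX : diffeology R X) (f : I -> X -> Y).
Hypothesis f_surj : forall y, exists i x, f i x = y.

(** Plots are the maps that lift locally through some member of the family. This explicit model
    gives access to the local lifts of plots of diffeologies defined as intersections. *)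
Definition final_plot n (U : set 'rV[R]_n) (P : 'rV[R]_n -> Y) :=
  open U /\ forall u, U u -> exists V i Q,
    [/\ V u, V `<=` U, plot DX V Q & forall w, V w -> P w = f i (Q w)].

Lemma final_plot_eq n (U : set 'rV[R]_n) P Q :
  final_plot U P -> (forall u, U u -> P u = Q u) -> final_plot U Q.
Proof.
move=> [oU locP] PQ; split=> // u /locP[V [i [F [Vu VU pF PE]]]].
by exists V, i, F; split=> // w Vw; rewrite -PQ ?PE//; exact: VU.
Qed.

Lemma final_plot_cst n (U : set 'rV[R]_n) y :
  open U -> final_plot U (fun=> y).
Proof.
move=> oU; split=> // u Uu; have [i [x <-]] := f_surj y.
by exists U, i, (fun=> x); split=> //; exact: plot_cst.
Qed.

Lemma final_plot_local n (U : set 'rV[R]_n) P : open U ->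
  (forall u, U u -> exists V, [/\ open V, V u, V `<=` U & final_plot V P]) ->
  final_plot U P.
Proof.
move=> oU loc; split=> // u /loc[V [_ Vu VU [_ /(_ u Vu)]]].
move=> [W [i [Q [Wu WV pQ PE]]]]; exists W, i, Q; split=> //.
exact: subset_trans VU.
Qed.

Lemma final_plot_comp m n (V : set 'rV[R]_m) (U : set 'rV[R]_n) F P :
  open V -> smooth_on V F -> (forall v, V v -> U (F v)) ->
  final_plot U P -> final_plot V (P \o F).
Proof.
move=> oV sF VU [oU locP]; split=> // v Vv.
have [W [i [Q [Wv WU pQ PE]]]] := locP _ (VU v Vv).
have oVW := open_smooth_preimage oV (plot_open pQ) sF.
exists (V `&` F @^-1` W), i, (Q \o F); split=> //.
- have sFW : smooth_on (V `&` F @^-1` W) F by exact: smooth_on_sub sF.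
  by apply: (plot_comp oVW sFW _ pQ) => w [].
- by move=> w [_ Ww] /=; exact: PE.
Qed.

Definition final_diffeology : diffeology R Y :=
  Diffeology (fun n U P => @proj1 _ _) final_plot_eq final_plot_cst
    final_plot_local final_plot_comp.

End final_diffeology.

(** The final diffeology of the projection makes the projection smooth, so it is among the
    diffeologies whose intersection is the quotient diffeology. *)
Lemma quotient_plot_lift d (I : zmodClosed 'rV[R]_d) n (U : set 'rV[R]_n) P u :
  plot (quotient_diffeology I) U P -> U u ->
  exists V Q, [/\ V u, V `<=` U, plot (std_diffeology R d) V Q &
    forall w, V w -> P w = \pi_(Quotient.quot I)%qT (Q w)].
Proof.
move=> [oU pP] Uu.
have pi_surj (y : Quotient.quot I) :
    exists (i : unit) x, \pi_(Quotient.quot I)%qT x = y.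
  by exists tt, (repr y); rewrite reprK.
have /pP[_ /(_ u Uu)] :
    smooth (std_diffeology R d) (final_diffeology (std_diffeology R d) pi_surj)
      \pi_(Quotient.quot I)%qT.
  move=> k V Q pQ; split=> [|w Vw]; first exact: plot_open pQ.
  by exists V, tt, Q; split.
by move=> [V [_ [Q VQ]]]; exists V, Q.
Qed.

Lemma quotient_plot_pi d (I : zmodClosed 'rV[R]_d) n (U : set 'rV[R]_n) Q :
  plot (std_diffeology R d) U Q ->
  plot (quotient_diffeology I) U (fun u => \pi_(Quotient.quot I)%qT (Q u)).
Proof.
move=> pQ; split; first exact: plot_open pQ.
by move=> D; exact.
Qed.

Lemma smooth_tiling_action d (O : tiling_space R d) :
  @smooth_action R d O (tiling_diffeology O).
Proof. by case: (tiling_diffeology_finest O). Qed.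

Lemma tiling_plot_lift d (O : tiling_space R d) n (U : set 'rV[R]_n) P u :
  plot (tiling_diffeology O) U P -> U u ->
  exists V S Q, [/\ V u, V `<=` U, plot (std_diffeology R d) V Q &
    forall w, V w -> P w = action (Q w, S)].
Proof.
move=> [oU pP] Uu.
have act_surj (S : {T | O T}) : exists S' x, action (x, S') = S.
  exists S, 0; case: S => S OS; apply: eq_exist => /=.
  exact: translate_tiling0.
(* The diffeology generated by the orbit maps makes the action smooth, because translating [S + F z]
   by a vector [y] gives [S + (F z + y)]. *)
have /pP[_ /(_ u Uu)//] : smooth_action (final_diffeology (std_diffeology R d) act_surj).
move=> k V Q [pQ1 [oV locQ]]; split=> // w /locQ[W [S [F [Ww WV pF QE]]]].
have oW := plot_open pF.
exists W, S, (fun z => F z + (Q z).1); split=> //.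
  split=> //; apply: smooth_onD => //; first by case: pF.
  by case: pQ1 => _; exact: smooth_on_sub.
move=> z Wz; apply: eq_exist => /=; rewrite translate_tilingD.
by rewrite -[(Q z).2]/((snd \o Q) z) QE.
Qed.

End diffeology_theory.

(** * The structure groupoid *)

Section functional_diffeology.
Variables (R : realType) (X B : Type).
Variables (DX : diffeology R X) (DB : diffeology R B) (p : X -> B).
Local Notation arrow := (arrow DX p).

(* Outside the source fiber of [a], [ev a] is the identity. *)
Definition ev (a : arrow) (x : X) : X :=
  if pselect (p x = source a) is left e then sval (arrow_map (exist _ x e)) else x.

Lemma evE (a : arrow) (z : fiber p (source a)) : ev a (sval z) = sval (arrow_map z).
Proof.
case: z => x e; rewrite /ev /=; case: pselect => // e'.
by rewrite (Prop_irrelevance e' e).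
Qed.

Lemma ev_target (a : arrow) x : p x = source a -> p (ev a x) = target a.
Proof. by move=> e; rewrite (evE (exist _ x e)); exact: (svalP (arrow_map _)). Qed.

Lemma ev_comp (fg : composable DX p) x : p x = source (sval fg).1 ->
  ev (comp_arrow fg) x = ev (sval fg).2 (ev (sval fg).1 x).
Proof.
move=> e; rewrite (evE (a := comp_arrow fg) (exist _ x e)) (evE (exist _ x e)).
by rewrite -(evE (fiber_cast (svalP fg) (arrow_map (exist _ x e)))).
Qed.

Lemma ev_inv_comp (fg : composable DX p) x : p x = target (sval fg).2 ->
  ev (inv_arrow (comp_arrow fg)) x =
  ev (inv_arrow (sval fg).1) (ev (inv_arrow (sval fg).2) x).
Proof.
move=> e; rewrite (evE (a := inv_arrow (comp_arrow fg)) (exist _ x e)).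
rewrite (evE (a := inv_arrow (sval fg).2) (exist _ x e)).
by rewrite -(evE (a := inv_arrow (sval fg).1)
  (fiber_cast (esym (svalP fg)) (arrow_inv (exist _ x e)))).
Qed.

(** Smooth source and smooth evaluation. The change of variables [F] is needed because a plot of the
    domain of evaluation pairs arrows and points over a common parameter. *)
Definition ev_plot n (U : set 'rV[R]_n) (P : 'rV[R]_n -> arrow) :=
  plot DB U (fun u => source (P u)) /\
  forall m (V : set 'rV[R]_m) F x, smooth_on V F -> (forall v, V v -> U (F v)) ->
    plot DX V x -> (forall v, V v -> p (x v) = source (P (F v))) ->
    plot DX V (fun v => ev (P (F v)) (x v)).

Lemma ev_plot_eq n (U : set 'rV[R]_n) P Q :
  ev_plot U P -> (forall u, U u -> P u = Q u) -> ev_plot U Q.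
Proof.
move=> [sP eP] PQ; split=> [|m V F x sF VU px xP].
  by apply: plot_eq sP _ => u Uu /=; rewrite PQ.
apply: plot_eq (eP m V F x sF VU px _) _ => v Vv; rewrite PQ//; try exact: VU.
exact: xP.
Qed.

Lemma ev_plot_cst n (U : set 'rV[R]_n) a : open U -> ev_plot U (fun=> a).
Proof.
move=> oU; split=> [|m V F x _ _ px xa]; first exact: plot_cst.
apply: (plot_smooth_sub (A := fun y => p y = source a)
  (f := fun z => sval (arrow_map z)) (g := ev a)) px xa => [|z].
  exact: (arrow_map_smooth (a := a)).
by rewrite evE.
Qed.

Lemma ev_plot_local n (U : set 'rV[R]_n) P : open U ->
  (forall u, U u -> exists V, [/\ open V, V u, V `<=` U & ev_plot V P]) ->
  ev_plot U P.
Proof.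
move=> oU loc; split=> [|m V F x sF VU px xP].
  by apply: plot_local => // u /loc[V [oV Vu VU [sP _]]]; exists V.
have oV := plot_open px.
apply: plot_local => // v Vv; have [W [oW Wv _ [_ eP]]] := loc _ (VU v Vv).
have oVW := open_smooth_preimage oV oW sF.
exists (V `&` F @^-1` W); split=> //.
apply: eP; [exact: smooth_on_sub sF|by move=> w []|exact: plot_sub px|].
by move=> w [/xP].
Qed.

Lemma ev_plot_comp m n (V : set 'rV[R]_m) (U : set 'rV[R]_n) F P :
  open V -> smooth_on V F -> (forall v, V v -> U (F v)) ->
  ev_plot U P -> ev_plot V (P \o F).
Proof.
move=> oV sF VU [sP eP]; split; first exact: plot_comp oV sF VU sP.
move=> k W G x sG WV px xP; have oW := plot_open px.
apply: (eP k W (F \o G)) => //; first exact: smooth_on_comp oW WV sG sF.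
by move=> w /WV /VU.
Qed.

(** Imposing the condition on the inverses too makes inversion smooth, and also the target, which is
    the source of the inverse. *)
Definition arrow_plot n (U : set 'rV[R]_n) (P : 'rV[R]_n -> arrow) :=
  ev_plot U P /\ ev_plot U (@inv_arrow R X B DX p \o P).

Lemma arrow_plot_open n (U : set 'rV[R]_n) P : arrow_plot U P -> open U.
Proof. by move=> [[/plot_open]]. Qed.

Lemma arrow_plot_eq n (U : set 'rV[R]_n) P Q :
  arrow_plot U P -> (forall u, U u -> P u = Q u) -> arrow_plot U Q.
Proof.
move=> [eP iP] PQ; split; first exact: ev_plot_eq eP PQ.
by apply: ev_plot_eq iP _ => u Uu /=; rewrite PQ.
Qed.

Lemma arrow_plot_cst n (U : set 'rV[R]_n) a : open U -> arrow_plot U (fun=> a).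
Proof. by move=> oU; split; exact: ev_plot_cst. Qed.

Lemma arrow_plot_local n (U : set 'rV[R]_n) P : open U ->
  (forall u, U u -> exists V, [/\ open V, V u, V `<=` U & arrow_plot V P]) ->
  arrow_plot U P.
Proof.
move=> oU loc.
by split; apply: ev_plot_local => // u /loc[V [oV Vu VU [eP iP]]]; exists V.
Qed.

Lemma arrow_plot_comp m n (V : set 'rV[R]_m) (U : set 'rV[R]_n) F P :
  open V -> smooth_on V F -> (forall v, V v -> U (F v)) ->
  arrow_plot U P -> arrow_plot V (P \o F).
Proof.
move=> oV sF VU [eP iP]; split; first exact: ev_plot_comp eP.
exact: ev_plot_comp iP.
Qed.

Definition functional_diffeology : diffeology R arrow :=
  Diffeology arrow_plot_open arrow_plot_eq arrow_plot_cst arrow_plot_local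
    arrow_plot_comp.

Lemma functional_groupoid_diffeology : groupoid_diffeology DB functional_diffeology.
Proof.
split.
- by move=> n U P [[]].
- by move=> n U P [_ []].
- have ev_unit b x : ev (unit_arrow DX p b) x = x by rewrite /ev; case: pselect.
  move=> n U P pP; have eP : ev_plot U (@unit_arrow R X B DX p \o P).
    split=> // m V F x _ _ px _; apply: plot_eq px _ => v _.
    by rewrite ev_unit.
  by split.
- by move=> n U P [eP iP]; split.
- move=> n U P [[[sf ef] [tf if_]] [[sg eg] [tg ig]]]; split; split=> //.
    move=> m V F x sF VU px xP.
    apply: plot_eq (eg m V F _ sF VU (ef m V F x sF VU px xP) _) _ => v Vv.
      by rewrite (ev_target (a := (sval (P (F v))).1) (xP v Vv)) (svalP (P (F v))).
    by rewrite /= (ev_comp (fg := P (F v)) (xP v Vv)).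
  (* The inverse of a composite evaluates the two inverses in the opposite order. *)
  move=> m V F x sF VU px xP.
  apply: plot_eq (if_ m V F _ sF VU (ig m V F x sF VU px xP) _) _ => v Vv.
    rewrite (ev_target (a := inv_arrow (sval (P (F v))).2) (xP v Vv)).
    by rewrite /= (svalP (P (F v))).
  by rewrite /= (ev_inv_comp (fg := P (F v)) (xP v Vv)).
Qed.

Lemma functional_smooth_evaluation : smooth_evaluation functional_diffeology.
Proof.
move=> n U P [[[_ eP] _] px]; have oU := plot_open px.
apply: plot_eq (eP n U id _ (smooth_on_id oU) (fun=> id) px _) _ => u Uu.
  exact: svalP (P u).
by rewrite /= /evaluation -evE.
Qed.

(** For a competing [D], a plot of arrows and a plot of points in their sources form a plot of the
    domain of evaluation, whence [ev_plot]; smooth inversion gives the condition on inverses. *)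
Lemma functional_diffeology_coarsest :
  coarsest (fun D => groupoid_diffeology DB D /\ smooth_evaluation D)
    functional_diffeology.
Proof.
split.
  split; first exact: functional_groupoid_diffeology.
  exact: functional_smooth_evaluation.
move=> D [[sD _ _ iD _] eD].
suff ev_plotD n U P : plot D U P -> @ev_plot n U P.
  by move=> n U P pP; split; apply: ev_plotD => //; exact: iD.
move=> pP; split=> [|m V F x sF VU px xP]; first exact: sD.
have oV := plot_open px.
apply: (@plot_smooth_sub _ _ _ _ _ _ _ (fun ax => ev ax.1 ax.2) _ V
  (fun v => (P (F v), x v)) eD) => //; first by move=> ax; rewrite /evaluation -evE.
by split=> //; exact: plot_comp oV sF VU pP.
Qed.

End functional_diffeology.

(** * Fibrations over R^d / I from an action lifting the translations *)

Section translation_fibration.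
Variables (R : realType) (d : nat) (I : zmodClosed 'rV[R]_d).
Local Notation E := 'rV[R]_d.
Local Notation torus := (Quotient.quot I).
Local Notation proj := (\pi_torus%qT : E -> torus).
Variables (X : Type) (DX : diffeology R X) (p : X -> torus) (act : E -> X -> X).
Hypothesis act_smooth :
  smooth (prod_diffeology (std_diffeology R d) DX) DX (fun yx => act yx.1 yx.2).
Hypothesis p_act : forall b y x, p x = proj b -> p (act y x) = proj (b + y).
Hypothesis actK : forall y, cancel (act y) (act (- y)).

Section translation_arrow.
Variables b y : E.

Definition act_fiber (z : fiber p (proj b)) : fiber p (proj (b + y)) :=
  exist _ (act y (sval z)) (p_act y (svalP z)).

Fact p_actN x : p x = proj (b + y) -> p (act (- y) x) = proj b.
Proof. by move=> /(p_act (- y)); rewrite addrK. Qed.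

Definition act_fiber_inv (z : fiber p (proj (b + y))) : fiber p (proj b) :=
  exist _ (act (- y) (sval z)) (p_actN (svalP z)).

Fact act_fiberK : cancel act_fiber act_fiber_inv.
Proof. by case=> x e; apply: eq_exist => /=; rewrite actK. Qed.

Fact act_fiber_invK : cancel act_fiber_inv act_fiber.
Proof. by case=> x e; apply: eq_exist => /=; rewrite -{1}(opprK y) actK. Qed.

Lemma act_plot n (U : set 'rV[R]_n) f P :
  plot (std_diffeology R d) U f -> plot DX U P ->
  plot DX U (fun u => act (f u) (P u)).
Proof. by move=> pf pP; exact: (act_smooth (P := fun u => (f u, P u))). Qed.

Fact act_fiber_smooth :
  smooth (fiber_diffeology DX p (proj b))
    (fiber_diffeology DX p (proj (b + y))) act_fiber.
Proof.
move=> n U P pP; apply: (act_plot _ pP).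
exact: (plot_cst (std_diffeology R d) _ (plot_open pP)).
Qed.

Fact act_fiber_inv_smooth :
  smooth (fiber_diffeology DX p (proj (b + y)))
    (fiber_diffeology DX p (proj b)) act_fiber_inv.
Proof.
move=> n U P pP; apply: (act_plot _ pP).
exact: (plot_cst (std_diffeology R d) _ (plot_open pP)).
Qed.

Definition act_arrow : arrow DX p :=
  Arrow act_fiberK act_fiber_invK act_fiber_smooth act_fiber_inv_smooth.

End translation_arrow.

Lemma ev_act_arrow b y x : p x = proj b -> ev (act_arrow b y) x = act y x.
Proof. by move=> e; rewrite (evE (a := act_arrow b y) (exist _ x e)). Qed.

Lemma ev_inv_act_arrow b y x : p x = proj (b + y) ->
  ev (inv_arrow (act_arrow b y)) x = act (- y) x.
Proof. by move=> e; rewrite (evE (a := inv_arrow (act_arrow b y)) (exist _ x e)). Qed.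

Lemma act_arrow_plot n (U : set 'rV[R]_n) f g :
  plot (std_diffeology R d) U f -> plot (std_diffeology R d) U g ->
  plot (functional_diffeology DX (quotient_diffeology I) p) U
    (fun u => act_arrow (f u) (g u)).
Proof.
move=> pf pg; have [oU sf] := pf; have [_ sg] := pg; split; split.
- exact: quotient_plot_pi pf.
- move=> m V F x sF VU px xP; have oV := plot_open px.
  have pgF := plot_comp oV sF VU pg.
  by apply: plot_eq (act_plot pgF px) _ => v /xP /ev_act_arrow ->.
- apply: (@quotient_plot_pi _ _ _ _ _ (fun u => f u + g u)).
  by split=> //; exact: smooth_onD.
- move=> m V F x sF VU px xP; have oV := plot_open px.
  have pgF : plot (std_diffeology R d) V (fun v => - g (F v)).
    by split=> //; apply: smooth_onN => //; exact: smooth_on_comp VU sF sg.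
  by apply: plot_eq (act_plot pgF px) _ => v /xP /ev_inv_act_arrow ->.
Qed.

(** A plot of pairs of base points lifts locally to smooth maps [f] and [g] into R^d, and acting by
    [g - f] is a smooth family of arrows with these end points. Moving [x0] shows that no fiber is
    empty. *)
Lemma act_fibration (x0 : X) : smooth DX (quotient_diffeology I) p ->
  diffeological_fibration DX (quotient_diffeology I) p.
Proof.
move=> sp; split=> // [b|].
  exists (act (repr b - repr (p x0)) x0).
  by rewrite (@p_act (repr (p x0))) ?reprK// addrC subrK reprK.
set D := functional_diffeology DX (quotient_diffeology I) p.
exists D; split; first exact: functional_diffeology_coarsest.
have [sD tD _ _ _] := functional_groupoid_diffeology DX (quotient_diffeology I) p.
split=> [[b b']|n U P].
  exists (act_arrow (repr b) (repr b' - repr b)).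
  by rewrite /characteristic /= addrC subrK !reprK.
set DBB := prod_diffeology _ _; split=> [[p1 p2]|[_ /(_ DBB)]].
  split=> [|D' sD']; first exact: plot_open p1.
  apply: plot_local => [|u Uu]; first exact: plot_open p1.
  have [V1 [f [V1u V1U pf fP]]] := quotient_plot_lift p1 Uu.
  have [V2 [g [V2u V2U pg gP]]] := quotient_plot_lift p2 Uu.
  have oV : open (V1 `&` V2) by apply: openI; [exact: plot_open pf|exact: plot_open pg].
  exists (V1 `&` V2); split=> //; first by move=> w [/V1U].
  have pf' := plot_sub oV (@subIsetl _ V1 V2) pf.
  have [_ sg] := plot_sub oV (@subIsetr _ V1 V2) pg.
  have pgf : plot (std_diffeology R d) (V1 `&` V2) (fun w => g w - f w).
    by split=> //; apply: smooth_onD => //; apply: smooth_onN => //; case: pf'.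
  apply: plot_eq (sD' _ _ _ (act_arrow_plot pf' pgf)) _ => w [V1w V2w].
  rewrite /= /characteristic /= [f w + _]addrC subrK -fP// -gP//=.
  by rewrite -surjective_pairing.
(* Conversely, source and target are smooth, so the product diffeology is one of those intersected
   in the pushforward. *)
by apply=> k V Q pQ; split; [exact: sD|exact: tD].
Qed.

End translation_fibration.

(** * The covering *)

Lemma locally_cst_plot (R : realType) X (D : diffeology R X)
    n (U : set 'rV[R]_n) P :
  open U -> (forall u, U u -> \forall w \near u, P w = P u) -> plot D U P.
Proof.
move=> oU Pcst; apply: plot_local => // u Uu.
have : nbhs u (U `&` [set w | P w = P u]).
  by apply: filterI (Pcst u Uu); exact: open_nbhs_nbhs.
rewrite nbhsE => -[V [oV Vu] VUP]; exists V; split=> // [w /VUP[]//|].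
by apply: plot_eq (plot_cst D (P u) oV) _ => w /VUP[].
Qed.

Section orbit_covering.
Variables (R : realType) (d : nat) (Omega : tiling_space R d).
Variable I : zmodClosed 'rV[R]_d.
Variable r : R.
Hypothesis I_cobounded : forall x, exists2 w, w \in I & `|x - w| <= r.
Hypothesis I_countable : countable [set w | w \in I].
Local Notation torus := (Quotient.quot I).
Local Notation proj := (\pi_torus%qT : 'rV[R]_d -> torus).
Implicit Types (S : set (set 'rV[R]_d)) (x y b : 'rV[R]_d).

(** The choice is made from the orbit as a set, so it is the same for all tilings of the orbit; the
    orbit is nonempty, so the default [set0] is never chosen by failure. *)
Definition orbit_repr S : set (set 'rV[R]_d) :=
  xget set0 [set S' | exists x, S' = translate_tiling S x].

Lemma orbit_reprP S : exists x, orbit_repr S = translate_tiling S x.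
Proof.
exact: (@xgetPex _ set0 [set S' | exists x, S' = translate_tiling S x]
  (ex_intro _ _ (ex_intro _ 0 erefl))).
Qed.

Lemma orbit_repr_translate S x : orbit_repr (translate_tiling S x) = orbit_repr S.
Proof.
congr xget; rewrite predeqE => S'; split=> -[y ->].
  by exists (x + y); rewrite translate_tilingD.
by exists (y - x); rewrite -translate_tilingD addrC subrK.
Qed.

Definition position S : 'rV[R]_d :=
  xget 0 [set x | S = translate_tiling (orbit_repr S) x].

Lemma positionP S : translate_tiling (orbit_repr S) (position S) = S.
Proof.
have [x xE] := orbit_reprP S; apply/esym.
apply: (@xgetPex _ 0 [set x | S = translate_tiling (orbit_repr S) x]).
by exists (- x); rewrite /= xE -translate_tilingD subrr translate_tiling0.
Qed.

(** Both vectors carry the representative to the same tiling: [position] is equivariant only modulo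
    the stabilizer. *)
Lemma position_translate S x :
  position (translate_tiling S x) - (position S + x) \in
    Zspan (stabilizer (orbit_repr S)).
Proof.
apply: Zspan_sub; rewrite /stabilizer /= translate_tilingD.
have := positionP (translate_tiling S x); rewrite orbit_repr_translate => ->.
by rewrite -{1}(positionP S) -!translate_tilingD addrA subrr translate_tiling0.
Qed.

(** Depends on [S] through the representative only, hence is constant on orbits; for [S] in [Omega]
    a suitable matrix exists, so the default [1%:M] does not intervene. *)
Definition orbit_matrix S : 'M[R]_d :=
  xget 1%:M [set A | A \in unitmx /\
    forall x, x \in Zspan (stabilizer (orbit_repr S)) -> x *m A \in I].

Lemma orbit_matrix_translate S x :
  orbit_matrix (translate_tiling S x) = orbit_matrix S.
Proof. by rewrite /orbit_matrix orbit_repr_translate. Qed.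

Lemma orbit_matrixP S : Omega S -> orbit_matrix S \in unitmx /\
  forall x, x \in Zspan (stabilizer (orbit_repr S)) -> x *m orbit_matrix S \in I.
Proof.
move=> OS; apply: (@xgetPex _ 1%:M [set A | A \in unitmx /\
  forall x, x \in Zspan (stabilizer (orbit_repr S)) -> x *m A \in I]).
have [y ->] := orbit_reprP S.
have [e e0 eP] := stabilizer_discrete (tilings_tiling (tilings_translate y OS)).
by have [A uA AI] := discrete_embedding e0 eP I_cobounded; exists A.
Qed.

Definition orbit_proj (S : {T | Omega T}) : torus :=
  proj (position (sval S) *m orbit_matrix (sval S)).

(** The defect of equivariance of [position] lies in the stabilizer, which the matrix sends into
    [I]. *)
Lemma orbit_proj_action b x (S : {T | Omega T}) : orbit_proj S = proj b ->
  orbit_proj (action (x, S)) = proj (b + x *m orbit_matrix (sval S)).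
Proof.
have [_ AI] := orbit_matrixP (svalP S).
move=> /eqP; rewrite -Quotient.idealrBE => Sb.
apply/eqP; rewrite -Quotient.idealrBE /= orbit_matrix_translate.
apply: (eq_ind _ (fun z => is_true (z \in I))
  (rpredD (AI _ (position_translate (sval S) x)) Sb)).
rewrite mulmxBl mulmxDl addrA [position (sval S) *m _ + _]addrC.
by rewrite opprD addrA subrK opprD addrA addrAC.
Qed.

Definition orbit_act y (S : {T | Omega T}) : {T | Omega T} :=
  action (y *m invmx (orbit_matrix (sval S)), S).

Lemma orbit_proj_act b y (S : {T | Omega T}) : orbit_proj S = proj b ->
  orbit_proj (orbit_act y S) = proj (b + y).
Proof.
by move=> /orbit_proj_action ->; rewrite mulmxKV//; case: (orbit_matrixP (svalP S)).
Qed.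

Lemma orbit_actK y : cancel (orbit_act y) (orbit_act (- y)).
Proof.
move=> [S OS]; apply: eq_exist => /=.
by rewrite orbit_matrix_translate mulNmx -translate_tilingD subrr translate_tiling0.
Qed.

(** A plot stays locally in one orbit, where the matrix is constant; there the action adds a smooth
    vector to [Q]. *)
Lemma orbit_act_smooth :
  smooth (prod_diffeology (std_diffeology R d) (tiling_diffeology Omega))
    (tiling_diffeology Omega) (fun yS => orbit_act yS.1 yS.2).
Proof.
move=> n U P [[_ sP] pP]; have oU := plot_open pP.
apply: plot_local => // u Uu.
have [V [S [Q [Vu VU [oV sQ] PE]]]] := tiling_plot_lift pP Uu.
exists V; split=> //.
have pf : plot (std_diffeology R d) V
    (fun w => Q w + (P w).1 *m invmx (orbit_matrix (sval S))).
  split=> //; apply: smooth_onD => //; apply: smooth_on_mulmx => //.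
  exact: smooth_on_sub sP.
have := smooth_tiling_action (P := fun w => (_, S))
  (conj pf (plot_cst (tiling_diffeology Omega) S oV)).
move=> /plot_eq; apply=> w Vw; apply: eq_exist => /=.
rewrite -[(P w).2]/((snd \o P) w) PE//= orbit_matrix_translate.
by rewrite translate_tilingD.
Qed.

Lemma orbit_proj_smooth :
  smooth (tiling_diffeology Omega) (quotient_diffeology I) orbit_proj.
Proof.
move=> n U P pP; apply: plot_local => [|u Uu]; first exact: plot_open pP.
have [V [S [Q [Vu VU [oV sQ] PE]]]] := tiling_plot_lift pP Uu.
exists V; split=> //; pose A := orbit_matrix (sval S).
have pf : plot (std_diffeology R d) V (fun w => position (sval S) *m A + Q w *m A).
  by split=> //; apply: smooth_onD; [|exact: smooth_on_cst|exact: smooth_on_mulmx].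
apply: plot_eq (quotient_plot_pi I pf) _ => w Vw /=.
by rewrite PE// (orbit_proj_action _ erefl).
Qed.

(** For a plot [S + Q w] inside a fiber, [(Q w - Q u) *m A] is continuous with values in the
    countable [I], hence locally constant; as [A] is invertible, so is [Q]. *)
Lemma orbit_proj_fiber_discrete (c : torus) :
  discrete_diffeology (fiber_diffeology (tiling_diffeology Omega) orbit_proj c).
Proof.
move=> n U P; split=> [pP|[oU Pcst]]; last exact: locally_cst_plot.
split=> [|u Uu]; first exact: plot_open pP.
have [V [S [Q [Vu VU [oV sQ] PE]]]] := tiling_plot_lift pP Uu.
have [uA _] := orbit_matrixP (svalP S); set A := orbit_matrix _ in uA.
have QI w : V w -> (Q w - Q u) *m A \in I.
  move=> Vw; have projE z : V z ->
      c = proj (position (sval S) *m A + Q z *m A).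
    move=> Vz; rewrite -(orbit_proj_action (Q z) erefl) -PE//.
    exact/esym/(svalP (P z)).
  have /eqP := etrans (esym (projE w Vw)) (projE u Vu).
  by rewrite -Quotient.idealrBE mulmxBl opprD addrACA subrr add0r.
have sf : smooth_on V (fun w => (Q w - Q u) *m A).
  by apply: smooth_on_mulmx => //; apply: smooth_onD => //; exact: smooth_on_cst.
have fcst := continuous_countable_locally_cst oV Vu
  (fun w => smooth_on_continuous sf) I_countable QI.
have nV : nbhs u V by exact: open_nbhs_nbhs.
move: fcst nV; apply: filterS2 => w; rewrite subrr mul0mx => QA Vw.
have QE : Q w = Q u.
  by apply/eqP; rewrite -subr_eq0 -(mulmxK uA (Q w - Q u)) QA mul0mx.
have : sval (P w) = sval (P u) by rewrite (PE w Vw) (PE u Vu) QE.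
by case: (P w) (P u) => [S1 e1] [S2 e2] /= S12; exact: eq_exist.
Qed.

Lemma orbit_covering_space (S0 : {T | Omega T}) :
  covering_space (tiling_diffeology Omega) (quotient_diffeology I).
Proof.
exists orbit_proj; split; last exact: orbit_proj_fiber_discrete.
exact: (act_fibration orbit_act_smooth orbit_proj_act orbit_actK S0 orbit_proj_smooth).
Qed.

End orbit_covering.

Theorem theoremA (R : realType) (d : nat) (V : vertex_map R d)
  (Omega : tiling_space R d)
  (rep : forall T : set (set 'rV[R]_d), Omega T -> repetitive T)
  (T : set (set 'rV[R]_d)) (OT : Omega T)
  (v : 'rV[R]_d) (Tv : tiling_vertices V T v) :
  covering_space (tiling_diffeology Omega)
    (quotient_diffeology (return_module V T v)).
Proof.
have tT := tilings_tiling OT.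
have [r rP] := return_module_cobounded V v tT.
exact: (orbit_covering_space rP (countable_return_module V v tT) (exist _ T OT)).
Qed.
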